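(* Let $q>3$ be a prime and let $d$ be a squarefree integer. Let $K=\mathbb{Q}(\sqrt[3]{d})$ be a cubic number field with ring of integers $\mathcal{O}_K$. Let $N\equiv 1 \pmod 3$ be a positive integer such that $N^2+N+1=kq$ for some positive integer $k<\sqrt{N}$. Assume $\gcd(N,3d)=1$ and $d^{\frac{N-1}{3}}\not\equiv 1 \pmod N$. Set $\mathcal{R}_N=\mathcal{O}_K/N\mathcal{O}_K$. Suppose there exists an element $w\in\mathcal{G}_N(d)$ such that $w^k\not\equiv 1 \pmod N$ (that is, $w^k\neq 1$ in $\mathcal{R}_N$). Then $N$ is prime if and only if $\Phi_q(w^k)\equiv 0 \pmod N$ (that is, $\Phi_q(w^k)=0$ in $\mathcal{R}_N$).
   Context: For the ring $\mathcal{R}_N=\mathcal{O}_K/N\mathcal{O}_K$, congruences modulo $N$ between elements of $\mathcal{R}_N$ mean equality in $\mathcal{R}_N$. The generalized unitary group is $\mathcal{G}_N(d):=\{w\in\mathcal{R}_N^\times \mid w^{N^2+N+1}=1 \text{ in } \mathcal{R}_N\}$. For a prime $q$, $\Phi_q(x)=x^{q-1}+x^{q-2}+\cdots+x+1$ is the $q$-th cyclotomic polynomial. *)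

(* Defs.v *)
From HB Require Import structures.
From mathcomp Require Import all_boot all_order all_algebra all_field.
From mathcomp Require Import generic_quotient ring_quotient.
From mathcomp Require Import boolp.

Set Implicit Arguments.
Unset Strict Implicit.
Unset Printing Implicit Defensive.

Import GRing.Theory Num.Theory.
Local Open Scope ring_scope.
Local Open Scope quotient_scope.

Definition squarefreez (d : int) : Prop :=
  forall m : int, (m ^+ 2 %| d)%Z -> `|m|%N = 1%N.

Section RingOfIntegers.
Variable K : fieldExtType rat.

Definition is_integer : {pred K} :=
  fun x => `[< integralOver (intr : int -> K) x >].

Lemma is_integerP (x : K) :
  reflect (integralOver (intr : int -> K) x) (x \in is_integer).
Proof. exact: asboolP. Qed.

Fact is_integer_subring_closed : subring_closed is_integer.
Proof.
split=> [|x y /is_integerP xI /is_integerP yI|x y /is_integerP xI /is_integerP yI].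
- exact/is_integerP/integral1.
- exact/is_integerP/integral_sub.
- exact/is_integerP/integral_mul.
Qed.
HB.instance Definition _ :=
  GRing.isSubringClosed.Build K is_integer is_integer_subring_closed.

Definition ring_of_integers := {x : K | x \in is_integer}.
HB.instance Definition _ := SubType.on ring_of_integers.
HB.instance Definition _ := Choice.on ring_of_integers.
HB.instance Definition _ :=
  [SubChoice_isSubComNzRing of ring_of_integers by <:].

End RingOfIntegers.

(* The quotient A / aA by a principal ideal.  The library's [{ideal_quot I}]
   requires a proper ideal; the quotient is redone here as a possibly trivial
   ring ([comPzRingType]), on top of the library's additive quotient, so that
   nothing has to be assumed about a. *)
Section PrincipalQuotient.
Variables (A : comNzRingType) (a : A).

Definition principal_ideal : {pred A} :=
  fun x => `[< exists y : A, x = a * y >].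

Lemma principal_idealP (x : A) :
  reflect (exists y : A, x = a * y) (x \in principal_ideal).
Proof. exact: asboolP. Qed.

Fact principal_ideal_zmod_closed : zmod_closed principal_ideal.
Proof.
split; first by apply/principal_idealP; exists 0; rewrite mulr0.
move=> x y /principal_idealP[u ->] /principal_idealP[v ->].
by apply/principal_idealP; exists (u - v); rewrite mulrBr.
Qed.
HB.instance Definition _ :=
  GRing.isZmodClosed.Build A principal_ideal principal_ideal_zmod_closed.

Lemma principal_idealMl (x y : A) :
  y \in principal_ideal -> x * y \in principal_ideal.
Proof.
move=> /principal_idealP[u ->]; apply/principal_idealP.
by exists (x * u); rewrite mulrCA.
Qed.

Definition principal_quot := Quotient.quot principal_ideal.
HB.instance Definition _ := GRing.Zmodule.on principal_quot.
HB.instance Definition _ := ZmodQuotient.on principal_quot.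

Lemma principal_quotP (x y : A) :
  reflect (\pi_principal_quot x = \pi_principal_quot y)
          (x - y \in principal_ideal).
Proof. by rewrite Quotient.idealrBE; apply: eqP. Qed.

Definition pq_one : principal_quot := lift_cst principal_quot 1.
Definition pq_mul := lift_op2 principal_quot *%R.

Canonical pi_pq_one_morph := PiConst pq_one.

Lemma pi_pq_mul : {morph \pi_principal_quot : x y / x * y >-> pq_mul x y}.
Proof.
move=> x y; unlock pq_mul; apply/principal_quotP.
have piE z : z - repr (\pi_principal_quot z) \in principal_ideal.
  by apply/principal_quotP; rewrite reprK.
set x' := repr _; set y' := repr _.
have -> : x * y - x' * y' = y * (x - x') + x' * (y - y').
  by rewrite !mulrBr [y * x]mulrC [y * x']mulrC addrA subrK.
by apply: rpredD; apply: principal_idealMl; apply: piE.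
Qed.
Canonical pi_pq_mul_morph := PiMorph2 pi_pq_mul.

Fact pq_mulA : associative pq_mul.
Proof. by move=> x y z; rewrite -[x]reprK -[y]reprK -[z]reprK !piE mulrA. Qed.

Fact pq_mulC : commutative pq_mul.
Proof. by move=> x y; rewrite -[x]reprK -[y]reprK !piE mulrC. Qed.

Fact pq_mul1 : left_id pq_one pq_mul.
Proof. by move=> x; rewrite -[x]reprK !piE mul1r. Qed.

Fact pq_mulDl : left_distributive pq_mul +%R.
Proof.
move=> x y z; rewrite -[x]reprK -[y]reprK -[z]reprK.
by rewrite !piE mulrDl.
Qed.

HB.instance Definition _ :=
  GRing.Zmodule_isComPzRing.Build principal_quot pq_mulA pq_mulC pq_mul1 pq_mulDl.

(* A named copy of [\pi], whose morphism instance is reserved by the library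
   for nontrivial quotients. *)
Definition pq_proj (x : A) : principal_quot := \pi_principal_quot x.

Fact pq_proj_is_zmod_morphism : zmod_morphism pq_proj.
Proof. by move=> x y; rewrite /pq_proj !piE. Qed.
HB.instance Definition _ :=
  GRing.isZmodMorphism.Build A principal_quot pq_proj pq_proj_is_zmod_morphism.

Fact pq_proj_is_monoid_morphism : monoid_morphism pq_proj.
Proof. by split=> [|x y]; rewrite /pq_proj ?pi_pq_mul // !piE. Qed.
HB.instance Definition _ :=
  GRing.isMonoidMorphism.Build A principal_quot pq_proj pq_proj_is_monoid_morphism.

Lemma pq_projP (x y : A) :
  reflect (pq_proj x = pq_proj y) (x - y \in principal_ideal).
Proof. exact: principal_quotP. Qed.

Lemma pq_proj_surj (u : principal_quot) : exists x : A, u = pq_proj x.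
Proof. by exists (repr u); rewrite /pq_proj reprK. Qed.

End PrincipalQuotient.

Definition residue_ring (K : fieldExtType rat) (N : nat) : comPzRingType :=
  principal_quot (N%:R : ring_of_integers K).

(* [GRing.unit] is only available for nontrivial rings. *)
Definition invertible (R : comPzRingType) (w : R) : Prop :=
  exists v : R, w * v = 1.

Definition gen_unitary (K : fieldExtType rat) (N : nat)
    (w : residue_ring K N) : Prop :=
  invertible w /\ w ^+ (N ^ 2 + N + 1) = 1.

Definition Phi (q : nat) (R : comPzRingType) (x : R) : R :=
  \sum_(i < q) x ^+ i.

Lemma Phi_Cyclotomic (q : nat) :
  prime q -> Phi q ('X : {poly int}) = Cyclotomic q.
Proof.
move=> q_pr; have q_gt0 := prime_gt0 q_pr.
have Phi1 : Cyclotomic 1 = 'X - 1.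
  by have := prod_Cyclotomic (ltnSn 0); rewrite big_seq1.
have divq : perm_eq (divisors q) [:: 1%N; q].
  apply: uniq_perm; rewrite ?divisors_uniq //=.
    by rewrite inE ltn_eqF ?prime_gt1.
  move=> m; rewrite -dvdn_divisors // !inE.
  by apply/idP/orP => [|[] /eqP->]; rewrite ?dvd1n ?dvdnn //; case/primeP: q_pr => _ h /h/orP.
have := prod_Cyclotomic q_gt0.
rewrite (perm_big _ divq) /= big_cons big_seq1 Phi1 subrX1 => /mulfI ->//.
by rewrite -polyC1 polyXsubC_eq0.
Qed.

(* Main.v *)
From HB Require Import structures.
Require Import Defs.
From mathcomp Require Import all_boot all_order all_algebra all_field.
From mathcomp Require Import boolp.
From mathcomp Require Import ring zify.

Set Implicit Arguments.
Unset Strict Implicit.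
Unset Printing Implicit Defensive.

Import GRing.Theory Num.Theory.
Local Open Scope ring_scope.

(** Both directions are computations with the Frobenius map on the ring O_K/p,
for a prime p that does not divide 3d, where t denotes the class of theta.

The only fact about O_K that is needed is that O_K/p is spanned by 1, t, t^2
over the integers ([residue_quadratic]). No trace or discriminant is computed.
Since t^3 = d, some power p^i with i = 2 or 3 satisfies t^(p^i) = t
([frob_exponent]), so the i-th iterate of Frobenius is the identity on
Z[theta]/p ([quadratic_frob_id]). That ring is therefore reduced. If z is
integral and y = pz lies in Z[theta], clearing denominators in the integral
equation of z shows that p divides a power of y in Z[theta]
([integral_mul_power]); so p divides y, and z is in Z[theta]. Hence the index
of Z[theta] in O_K is prime to p.

If Phi_q(w^k) = 0 and N is composite, take a prime p dividing N with p^2 <= N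
and let u be an image of w^k in O_K/p. Then u^q = 1 and u^(p^i) = u. The
bound k < sqrt N makes q larger than p^2 + p + 1 ([square_le_lt_cofactor]), so q
is prime to p^i - 1 and u = 1. Then 0 = Phi_q(1) = q in O_K/p, and as q is
prime to p this ring is trivial, that is 1/p is integral: a contradiction
([Phi_neq0_prime_divisor]).

If N = p is prime, Frobenius maps t to om t, where om = d^((p-1)/3) is different
from 1 and so is a primitive cube root of unity in Z/p. For nonzero v, the norm
v^(1 + p + p^2) is fixed by Frobenius, hence an integer class
([frob_fixed_intr]); it is nonzero because the ring is reduced. So O_K/p is a
field ([noncube_invertible]), and (u - 1) Phi_q(u) = u^q - 1 = 0 with u <> 1
gives Phi_q(u) = 0. *)

(** * Commutative rings of prime characteristic, possibly trivial *)

Section PrimeCharacteristic.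
Variables (S : comPzRingType) (p : nat).
Hypotheses (p_pr : prime p) (p0 : p%:R = 0 :> S).

Lemma natr_dvd_char m : (p %| m)%N -> m%:R = 0 :> S.
Proof. by case/dvdnP=> n ->; rewrite natrM p0 mulr0. Qed.

Lemma exprD_char (x y : S) : (x + y) ^+ p = x ^+ p + y ^+ p.
Proof.
have p_gt0 := prime_gt0 p_pr.
rewrite exprDn -(prednK p_gt0) big_ord_recl big_ord_recr /= big1 => [|i _].
  by rewrite subn0 subnn bin0 binn !mulr1n expr0 mulr1 mul1r add0r.
rewrite -mulr_natr natr_dvd_char ?mulr0 // prednK // prime_dvd_bin //.
by rewrite /bump /=; have := ltn_ord i; lia.
Qed.

Lemma expr_natr_char (m : nat) : (m%:R : S) ^+ p = m%:R.
Proof.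
elim: m => [|m IHm]; first by rewrite expr0n eqn0Ngt prime_gt0.
by rewrite -addn1 natrD exprD_char IHm expr1n.
Qed.

Lemma intr_char_nat (m : int) : exists n : nat, m%:~R = n%:R :> S.
Proof.
exists `|(m %% p%:Z)%Z|%N.
rewrite {1}(divz_eq m p%:Z) intrD intrM -!pmulrn p0 mulr0 add0r.
by rewrite pmulrn gez0_abs ?modz_ge0 // eqz_nat -lt0n prime_gt0.
Qed.

Lemma expr_intr_char (m : int) : (m%:~R : S) ^+ p = m%:~R.
Proof. by have [n ->] := intr_char_nat m; apply: expr_natr_char. Qed.

Lemma intr_char_inv (m : int) :
  coprimez p%:Z m -> exists n : int, m%:~R * n%:~R = 1 :> S.
Proof.
case/coprimezP=> -[u v] /= /(congr1 (fun z : int => z%:~R : S)).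
by rewrite intrD !intrM -pmulrn p0 mulr0 add0r mulrC => vm1; exists v.
Qed.

Lemma expr_predp_intr_char (m : int) :
  coprimez p%:Z m -> (m%:~R : S) ^+ p.-1 = 1.
Proof.
case/intr_char_inv=> n mn1; rewrite -[LHS]mulr1 -[X in _ * X]mn1 mulrA -exprSr.
by rewrite prednK ?prime_gt0 // expr_intr_char.
Qed.

Lemma expr_sum3_char i (x y z : S) :
  (x + y + z) ^+ (p ^ i) = x ^+ (p ^ i) + y ^+ (p ^ i) + z ^+ (p ^ i).
Proof.
elim: i => [|i IHi]; first by rewrite expn0 !expr1.
by rewrite expnSr !exprM IHi !exprD_char.
Qed.

Lemma expr_intr_char_iter i (m : int) : (m%:~R : S) ^+ (p ^ i) = m%:~R.
Proof.
by elim: i => [|i IHi]; rewrite ?expr1 // expnSr exprM IHi expr_intr_char.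
Qed.

End PrimeCharacteristic.

(** * Frobenius on the elements a + b t + c t^2 with t^3 = d *)

Definition quadratic (S : comPzRingType) (t : S) (a b c : int) : S :=
  a%:~R + b%:~R * t + c%:~R * t ^+ 2.

Lemma rmorph_quadratic (S T : comPzRingType) (f : {rmorphism S -> T}) t a b c :
  f (quadratic t a b c) = quadratic (f t) a b c.
Proof. by rewrite /quadratic !rmorphD 2!rmorphM rmorphXn !rmorph_int. Qed.

Section PureCubic.
Variables (S : comPzRingType) (p : nat) (d : int) (t : S).
Hypotheses (p_pr : prime p) (p0 : p%:R = 0 :> S) (cop_pd : coprimez p%:Z d).
Hypothesis t3 : t ^+ 3 = d%:~R.

Lemma expr_quadratic i a b c :
  quadratic t a b c ^+ (p ^ i) =
    a%:~R + b%:~R * t ^+ (p ^ i) + c%:~R * (t ^+ (p ^ i)) ^+ 2.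
Proof.
by rewrite /quadratic expr_sum3_char // !exprMn !expr_intr_char_iter // exprAC.
Qed.

(** The shape of the exponent makes t^(p^i) equal to t times a power of
d^(p-1), which is 1 by Fermat's little theorem. *)
Lemma quadratic_frob_id i j a b c :
  (p ^ i = 3 * p.-1 * j + 1)%N ->
  quadratic t a b c ^+ (p ^ i) = quadratic t a b c.
Proof.
move=> pij; rewrite expr_quadratic pij exprD expr1 -mulnA exprM t3.
by rewrite exprM expr_predp_intr_char // expr1n mul1r.
Qed.

End PureCubic.

(** For p = 3m + 1 the cofactor is (p^2 + p + 1) / 3. *)
Lemma frob_exponent3 p : p = 1 %[mod 3] ->
  exists j, (p ^ 3 = 3 * p.-1 * j + 1)%N.
Proof.
move=> p1; have [m ->] : exists m, p = (m * 3).+1.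
  by exists (p %/ 3)%N; rewrite {1}(divn_eq p 3) p1 addn1.
by exists (3 * m ^ 2 + 3 * m + 1)%N; rewrite /= !expnS expn0; lia.
Qed.

(** For p = 3m + 2 the cofactor is (p + 1) / 3. *)
Lemma frob_exponent2 p : p = 2 %[mod 3] ->
  exists j, (p ^ 2 = 3 * p.-1 * j + 1)%N.
Proof.
move=> p2; have [m ->] : exists m, p = (m * 3).+2.
  by exists (p %/ 3)%N; rewrite {1}(divn_eq p 3) p2 addn2.
by exists m.+1; rewrite /= !expnS expn0; lia.
Qed.

Lemma frob_exponent p : prime p -> coprime p 3 ->
  exists i j : nat, [/\ i = 2%N \/ i = 3%N & (p ^ i = 3 * p.-1 * j + 1)%N].
Proof.
move=> p_pr; rewrite coprime_sym prime_coprime // /dvdn.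
have: (p %% 3 < 3)%N by rewrite ltn_mod.
case Ep: (p %% 3)%N => [|[|[|//]]] // _ _.
  by have [//|j jE] := @frob_exponent3 p; exists 3, j; split; [right|].
by have [//|j jE] := @frob_exponent2 p; exists 2, j; split; [left|].
Qed.

(** * When p = 1 mod 3 and d is not a cube modulo p *)

Section PureCubicField.
Variables (S : comPzRingType) (p : nat) (d : int) (t : S).
Hypotheses (p_pr : prime p) (p0 : p%:R = 0 :> S) (cop_pd : coprimez p%:Z d).
Hypotheses (t3 : t ^+ 3 = d%:~R) (p1 : p = 1 %[mod 3]).
Hypothesis (noncube : (d ^+ (p.-1 %/ 3) != 1 %[mod p%:Z])%Z).
Hypothesis S_gen : forall s : S, exists a b c, s = quadratic t a b c.

(** The product of this sum with om - 1 is om^3 - 1 = d^(p-1) - 1 = 0, and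
om - 1 is invertible, being an integer prime to p. *)
Lemma cube_root_unity_sum (om := (d ^+ (p.-1 %/ 3))%:~R : S) :
  1 + om + om ^+ 2 = 0.
Proof.
have dvd3 : (3 %| p.-1)%N.
  by rewrite -subn1 -eqn_mod_dvd ?prime_gt0 //; apply/eqP.
have om3 : om ^+ 3 = 1.
  rewrite /om -rmorphXn /= -exprM divnK // rmorphXn /=.
  exact: expr_predp_intr_char.
have cop : coprimez p%:Z (d ^+ (p.-1 %/ 3) - 1).
  rewrite coprimezE prime_coprime //.
  by move: noncube; rewrite eqz_mod_dvd.
have [n n_inv] := intr_char_inv p0 cop.
have om1 : (om - 1) * n%:~R = 1 by rewrite -[RHS]n_inv intrD.
rewrite -[LHS]mul1r -[X in X * _]om1.
transitivity ((om ^+ 3 - 1) * n%:~R); first by ring.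
by rewrite om3 subrr mul0r.
Qed.

Lemma frob_generator : t ^+ p = (d ^+ (p.-1 %/ 3))%:~R * t.
Proof.
have dvd3 : (3 %| p.-1)%N.
  by rewrite -subn1 -eqn_mod_dvd ?prime_gt0 //; apply/eqP.
rewrite -[X in t ^+ X](prednK (prime_gt0 p_pr)) exprSr; congr (_ * _).
by rewrite -{1}(divnK dvd3) mulnC exprM t3 rmorphXn.
Qed.

(** Adding up n and its images under the first two powers of Frobenius kills the
coefficients of t and t^2, because 1 + om + om^2 = 0: so 3n = 3a. *)
Lemma frob_fixed_intr (n : S) : n ^+ p = n -> exists m : int, n = m%:~R.
Proof.
move=> np; have [a [b [c nE]]] := S_gen n; exists a.
have cop_p3 : coprimez p%:Z 3.
  by rewrite coprimezE /= coprime_sym prime_coprime // /dvdn p1.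
have [e e3] := intr_char_inv p0 cop_p3.
pose om : S := (d ^+ (p.-1 %/ 3))%:~R.
have sum0 : 1 + om + om ^+ 2 = 0 by exact: cube_root_unity_sum.
have frobE b' c' : quadratic t a b' c' ^+ p =
    a%:~R + b'%:~R * (om * t) + c'%:~R * (om * t) ^+ 2.
  have := @expr_quadratic _ p t p_pr p0 1 a b' c'.
  by rewrite expn1 frob_generator.
have E1 : n = a%:~R + b%:~R * (om * t) + c%:~R * (om * t) ^+ 2.
  by rewrite -{1}np nE frobE.
(* The image of the right-hand side of E1 under Frobenius. *)
have E2 : n = a%:~R + (b * d ^+ (p.-1 %/ 3))%:~R * (om * t) +
              (c * (d ^+ (p.-1 %/ 3)) ^+ 2)%:~R * (om * t) ^+ 2.
  rewrite -{1}np {1}E1 -[RHS]frobE; congr (_ ^+ p).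
  by rewrite /quadratic !intrM -/om; ring.
suff : 3%:~R * n = 3%:~R * a%:~R :> S.
  by move/(congr1 ( *%R e%:~R)); rewrite !mulrA [_ * 3%:~R]mulrC e3 !mul1r.
transitivity (n + n + n); first by ring.
rewrite {1}nE {1}E1 E2 /quadratic !intrM -/om.
transitivity (3%:~R * a%:~R + (b%:~R * t) * (1 + om + om ^+ 2) +
  (c%:~R * t ^+ 2) * (1 - om + om ^+ 2) * (1 + om + om ^+ 2)).
  by ring.
by rewrite sum0 !mulr0 !addr0.
Qed.

(** The norm v^(1 + p + p^2) is an integer. If p does not divide it then v is a
unit; otherwise v = v^(p^3) = 0. *)
Lemma noncube_invertible (v : S) : v != 0 -> exists v', v * v' = 1.
Proof.
have [j pj] := frob_exponent3 p1.
have frob3 : v ^+ (p ^ 3) = v.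
  have [a [b [c ->]]] := S_gen v.
  by rewrite (quadratic_frob_id p_pr p0 cop_pd t3 a b c pj).
have [|m nE] := @frob_fixed_intr (v ^+ (p ^ 2 + p + 1)).
  rewrite -exprM !mulnDl mul1n -expnSr mulnn !exprD frob3 expr1.
  by rewrite -mulrA mulrC.
move=> v_neq0.
have [p_dvd_m | ] := boolP (p %| `|m|)%N; last first.
  rewrite -prime_coprime // -(coprimezE p%:Z) => /(intr_char_inv p0)[e me].
  exists (v ^+ (p ^ 2 + p) * e%:~R).
  by rewrite mulrA -exprS -addn1 nE.
case/eqP: v_neq0; rewrite -frob3.
have -> : (p ^ 3 = p ^ 2 + p + 1 + (p ^ 3 - (p ^ 2 + p + 1)))%N.
  rewrite subnKC //; have p_gt1 := prime_gt1 p_pr.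
  have le2 : (2 * p <= p ^ 2)%N by rewrite -mulnn leq_mul2r p_gt1 orbT.
  have le3 : (2 * p ^ 2 <= p ^ 3)%N by rewrite (expnS p 2) leq_mul2r p_gt1 orbT.
  by move: (p ^ 2)%N (p ^ 3)%N le2 le3 => p2 p3; lia.
rewrite exprD nE (_ : m%:~R = 0) ?mul0r //.
have [/dvdzP[e ->]] : (p%:Z %| m)%Z by rewrite dvdzE.
by rewrite intrM -pmulrn p0 mulr0.
Qed.
End PureCubicField.

(** * The subring Z[theta] and integrality *)

Section IntegerPolynomials.
Variable (K : fieldExtType rat).
Implicit Types (x y z theta : K).

Lemma intr_inj_ext : injective (fun m : int => m%:~R : K).
Proof.
by move=> m n; rewrite -!(rmorph_int (GRing.in_alg K)) => /fmorph_inj/intr_inj.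
Qed.

(** All polynomials in theta are allowed, rather than those of degree less than
3, so that this is a subring for every theta; for theta = 0 it is the ring of
integers Z. *)
Definition int_adjoin theta : {pred K} :=
  fun x => `[< exists P : {poly int}, x = (map_poly intr P).[theta] >].

Lemma int_adjoinP theta x :
  reflect (exists P : {poly int}, x = (map_poly intr P).[theta])
          (x \in int_adjoin theta).
Proof. exact: asboolP. Qed.

Fact int_adjoin_subring_closed theta : subring_closed (int_adjoin theta).
Proof.
split=> [|x y|x y].
- by apply/int_adjoinP; exists 1; rewrite rmorph1 hornerC.
- move=> /int_adjoinP[P ->] /int_adjoinP[Q ->]; apply/int_adjoinP.
  by exists (P - Q); rewrite rmorphB !hornerE.
- move=> /int_adjoinP[P ->] /int_adjoinP[Q ->]; apply/int_adjoinP.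
  by exists (P * Q); rewrite rmorphM !hornerE.
Qed.
HB.instance Definition _ theta :=
  GRing.isSubringClosed.Build K (int_adjoin theta)
    (int_adjoin_subring_closed theta).

Definition adjoin_ring theta := {x : K | x \in int_adjoin theta}.
HB.instance Definition _ theta := SubType.on (adjoin_ring theta).
HB.instance Definition _ theta := Choice.on (adjoin_ring theta).
HB.instance Definition _ theta :=
  [SubChoice_isSubComNzRing of adjoin_ring theta by <:].

Lemma int_adjoin_gen theta : theta \in int_adjoin theta.
Proof. by apply/int_adjoinP; exists 'X; rewrite map_polyX hornerX. Qed.

Lemma int_adjoin_intr theta (m : int) : m%:~R \in int_adjoin theta.
Proof. by apply/int_adjoinP; exists m%:P; rewrite map_polyC hornerC. Qed.

Lemma int_adjoin0 x : x \in int_adjoin 0 -> exists m : int, x = m%:~R.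
Proof.
by case/int_adjoinP=> P ->; exists P.[0]; rewrite -horner_map rmorph0.
Qed.

Lemma int_adjoin_quadratic theta (d : int) x :
  theta ^+ 3 = d%:~R -> x \in int_adjoin theta ->
  exists a b c, x = quadratic theta a b c.
Proof.
move=> theta3 /int_adjoinP[P ->].
elim/poly_ind: P => [|P m [a [b [c IHP]]]].
  by exists 0, 0, 0; rewrite rmorph0 horner0 /quadratic !mul0r !addr0.
exists (m + c * d), a, b.
rewrite rmorphD rmorphM /= map_polyX map_polyC !hornerE IHP /quadratic.
by rewrite intrD intrM -theta3 /=; ring.
Qed.

(** Multiply an integral equation z^n + c_(n-1) z^(n-1) + ... = 0 by m^n: each
term but the first becomes m times a polynomial in mz. *)
Lemma integral_mul_power (A : subringClosed K) (m : nat) z :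
  z \in @is_integer K -> m%:R * z \in A ->
  exists n a, a \in A /\ (m%:R * z) ^+ n = m%:R * a.
Proof.
case/is_integerP=> P P_monic; rewrite rootE => /eqP Pz zA.
have := Pz; rewrite horner_coef size_map_poly_id0; last first.
  by rewrite (monicP P_monic) oner_eq0.
rewrite -(prednK (n := size P)) ?size_poly_gt0 ?monic_neq0 //.
set n := (size P).-1; rewrite big_ord_recr /=.
rewrite [(map_poly _ P)`_n]coef_map -/(lead_coef P) (monicP P_monic) mul1r.
move=> sum0; exists n.
exists (- \sum_(i < n) (P`_i)%:~R * (m%:R ^+ (n - i.+1) * (m%:R * z) ^+ i)).
split.
  rewrite rpredN; apply: rpred_sum => i _.
  by rewrite !rpredM ?rpredX ?rpred_nat ?rpred_int.
rewrite mulrN mulr_sumr exprMn; apply/eqP; rewrite -addr_eq0 addrC.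
apply/eqP; rewrite -[RHS](mulr0 (m%:R ^+ n)) -[in RHS]sum0 mulrDr.
congr (_ + _).
rewrite [RHS]mulr_sumr; apply: eq_bigr => i _; rewrite coef_map /= exprMn.
have -> : m%:R ^+ n = m%:R ^+ i * m%:R * m%:R ^+ (n - i.+1) :> K.
  by rewrite -exprSr -exprD subnKC.
ring.
Qed.

(** Apply the previous lemma to the ring Z: some power of 1 = pz would be
divisible by p in Z. *)
Lemma inv_prime_not_integer (p : nat) z :
  prime p -> p%:R * z = 1 -> z \notin @is_integer K.
Proof.
move=> p_pr pz; apply/negP => zI.
have [|n [a [/int_adjoin0[m ->]]]] :=
    @integral_mul_power (int_adjoin 0) p z zI.
  by rewrite pz rpred1.
rewrite pz expr1n pmulrn -intrM -[LHS]/(1%:~R).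
move=> /intr_inj_ext/esym/(congr1 absz); rewrite abszM /= => /eqP.
rewrite muln_eq1 => /andP[/eqP p1 _].
by rewrite p1 in p_pr.
Qed.

End IntegerPolynomials.

(** * The ring O_K/p is generated by theta when p does not divide 3d *)

Section PrimeIndex.
Variables (K : fieldExtType rat) (theta : K) (d : int) (p : nat).
Hypotheses (p_pr : prime p) (cop_p3 : coprime p 3) (cop_pd : coprimez p%:Z d).
Hypothesis theta3 : theta ^+ 3 = d%:~R.

(** Z[theta]/p is reduced: an iterate of Frobenius is the identity on it, so a
nilpotent y equals arbitrarily high powers of itself. *)
Lemma adjoin_ring_mod_reduced (y : adjoin_ring theta) n :
  (exists a, y ^+ n = p%:R * a) -> exists a, y = p%:R * a.
Proof.
case=> a yn; pose A := adjoin_ring theta.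
pose t : A := exist _ theta (int_adjoin_gen theta).
have t3 : t ^+ 3 = d%:~R.
  by apply: val_inj; rewrite rmorphXn rmorph_int.
have [a' [b' [c' yE]]] : exists a b c, y = quadratic t a b c.
  have [a' [b' [c' E]]] := int_adjoin_quadratic theta3 (valP y).
  exists a', b', c'; apply: val_inj.
  by rewrite rmorph_quadratic.
pose S := principal_quot (p%:R : A).
pose pi : {rmorphism A -> S} := @pq_proj A p%:R.
have p0 : p%:R = 0 :> S.
  rewrite -(rmorph_nat pi) -(rmorph0 pi); apply/pq_projP.
  by apply/principal_idealP; exists 1; rewrite subr0 mulr1.
have pit3 : pi t ^+ 3 = d%:~R by rewrite -rmorphXn t3 rmorph_int.
have [i [j [i23 pij]]] := frob_exponent p_pr cop_p3.
have i_gt0 : (0 < i)%N by case: i23 => ->.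
have pi_frob : pi y ^+ (p ^ i) = pi y.
  rewrite yE rmorph_quadratic.
  exact: (quadratic_frob_id p_pr p0 cop_pd pit3 a' b' c' pij).
have pi_frobX k : pi y ^+ ((p ^ i) ^ k)%N = pi y.
  by elim: k => [|k IHk]; rewrite ?expr1 // expnSr exprM IHk pi_frob.
have piy0 : pi y = 0.
  rewrite -(pi_frobX n).
  have -> : ((p ^ i) ^ n = n + ((p ^ i) ^ n - n))%N.
    rewrite subnKC //; apply/ltnW/ltn_expl.
    by rewrite (leq_trans (prime_gt1 p_pr)) // -{1}(expn1 p) leq_exp2l
               ?prime_gt1 // i_gt0.
  rewrite exprD -rmorphXn yn rmorphM rmorph_nat /=.
  by rewrite [X in X * _ * _]p0 !mul0r.
have /pq_projP/principal_idealP[e] : pi y = pi 0 by rewrite rmorph0.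
by rewrite subr0 => ->; exists e.
Qed.

Lemma int_adjoin_p_saturated z :
  z \in @is_integer K -> p%:R * z \in int_adjoin theta ->
  z \in int_adjoin theta.
Proof.
move=> zI pzA; have [n [a [aA pzn]]] := integral_mul_power zI pzA.
have [|e /(congr1 val)] :=
    @adjoin_ring_mod_reduced (exist _ (p%:R * z) pzA) n.
  exists (exist _ a aA); apply: val_inj.
  by rewrite rmorphXn rmorphM rmorph_nat.
rewrite rmorphM rmorph_nat /= => /mulfI ze.
suff p_neq0 : p%:R != 0 :> K by rewrite (ze p_neq0); exact: (svalP e).
rewrite pmulrn -[0]/(0%:~R) (inj_eq (@intr_inj_ext K)) eqz_nat.
by rewrite -lt0n prime_gt0.
Qed.

(** The factors p of m can be cancelled one at a time, by saturation. *)
Lemma int_adjoin_index_coprime m x :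
  (0 < m)%N -> x \in @is_integer K -> m%:R * x \in int_adjoin theta ->
  exists2 m', coprime p m' & m'%:R * x \in int_adjoin theta.
Proof.
move=> + xI; have [n] := ubnP m; elim: n m => // n IHn m ltmn m_gt0 mx.
have [/dvdnP[m1 mE]|] := boolP (p %| m)%N; last first.
  by rewrite -prime_coprime // => ?; exists m.
have m1_gt0 : (0 < m1)%N by move: m_gt0; rewrite mE muln_gt0 => /andP[].
apply: (IHn m1) => //.
  rewrite -ltnS (leq_trans _ ltmn) // ltnS mE ltn_Pmulr // prime_gt1 //.
apply: int_adjoin_p_saturated.
  by rewrite rpredM ?rpred_nat.
by rewrite mulrA -natrM mulnC -mE.
Qed.

Hypothesis K_gen : <<1; theta>>%VS = fullv.

Lemma int_adjoin_multiple x :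
  exists2 m, (0 < m)%N & m%:R * x \in int_adjoin theta.
Proof.
have : x \in <<1; theta>>%VS by rewrite K_gen memvf.
case/Fadjoin_polyP=> _ /polyOver1P[r ->] ->.
have [q [a a_neq0 ->]] := rat_poly_scale r.
have a_neq0K : a%:~R != 0 :> K.
  by rewrite -[0]/(0%:~R) (inj_eq (@intr_inj_ext K)).
exists `|a|%N; first by rewrite absz_gt0.
rewrite map_polyZ hornerZ fmorphV rmorph_int.
have -> : map_poly (GRing.in_alg K) (map_poly intr q) = map_poly intr q.
  by rewrite -map_poly_comp; apply: eq_map_poly => m;
     apply: (rmorph_int (GRing.in_alg K)).
rewrite pmulrn abszEsign intrM -mulrA mulVKf //.
by rewrite rpredM ?int_adjoin_intr //; apply/int_adjoinP; exists q.
Qed.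

Lemma theta_integer : theta \in @is_integer K.
Proof.
apply/is_integerP; exists ('X^3 - d%:P).
  by rewrite monicXnsubC.
by rewrite rootE rmorphB /= map_polyXn map_polyC !hornerE theta3 subrr.
Qed.

Lemma residue_ring_p_char : p%:R = 0 :> residue_ring K p.
Proof.
rewrite -(rmorph_nat (@pq_proj (ring_of_integers K) p%:R)).
rewrite -(rmorph0 (@pq_proj (ring_of_integers K) p%:R)); apply/pq_projP.
by apply/principal_idealP; exists 1; rewrite subr0 mulr1.
Qed.

Definition residue_theta : residue_ring K p :=
  pq_proj p%:R (exist _ theta theta_integer : ring_of_integers K).

Lemma residue_theta3 : residue_theta ^+ 3 = d%:~R.
Proof.
rewrite -rmorphXn -(rmorph_int (@pq_proj (ring_of_integers K) p%:R)).
congr pq_proj; apply: val_inj.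
by rewrite rmorphXn rmorph_int /= theta3.
Qed.

(** A multiple m x of a representative x, with m prime to p, lies in Z[theta],
and m can be inverted modulo p. *)
Lemma residue_quadratic (s : residue_ring K p) :
  exists a b c, s = quadratic residue_theta a b c.
Proof.
have [x ->] := pq_proj_surj s.
pose pi : {rmorphism ring_of_integers K -> residue_ring K p} :=
  @pq_proj (ring_of_integers K) p%:R.
have [m0 m0_gt0 m0x] := int_adjoin_multiple (val x).
have [m cop_pm /(int_adjoin_quadratic theta3)[a [b [c mx]]]] :=
  int_adjoin_index_coprime m0_gt0 (valP x) m0x.
have [n mn1] := intr_char_inv residue_ring_p_char (m := m%:Z) cop_pm.
exists (n * a), (n * b), (n * c).
have /(congr1 pi) : m%:R * x =
    quadratic (exist _ theta theta_integer : ring_of_integers K) a b c.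
  by apply: val_inj; rewrite rmorph_quadratic rmorphM rmorph_nat mx.
rewrite rmorph_quadratic rmorphM rmorph_nat -/residue_theta => mxE.
transitivity (n%:~R * (m%:R * pi x)).
  by rewrite mulrA [_ * m%:R]mulrC [X in X * _]mn1 mul1r.
by rewrite mxE /quadratic !intrM; ring.
Qed.

End PrimeIndex.

(** * Arithmetic of the primality criterion *)

Lemma expr_eq1_coprime (S : comPzRingType) (u : S) (q e : nat) :
  coprime q e -> (0 < q)%N -> u ^+ q = 1 -> u ^+ e.+1 = u -> u = 1.
Proof.
move=> cop q_gt0 uq ue; have ue_mul m : u ^+ (m * e + 1) = u.
  elim: m => [|m IHm]; first by rewrite expr1.
  by rewrite mulSn -addnA exprD IHm -exprSr.
have [m1 m2 m12 _] := egcdnP e q_gt0; rewrite -(ue_mul m2).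
by rewrite -(eqP cop) -m12 mulnC exprM uq expr1n.
Qed.

Lemma Phi_eq0_expr (S : comPzRingType) (u : S) q : Phi q u = 0 -> u ^+ q = 1.
Proof.
by move=> Phi0; apply/eqP; rewrite -subr_eq0 subrX1 -/(Phi q u) Phi0 mulr0.
Qed.

Lemma Phi_one (S : comPzRingType) q : Phi q (1 : S) = q%:R.
Proof.
rewrite /Phi (eq_bigr (fun=> 1)) => [|i _]; last by rewrite expr1n.
by rewrite sumr_const card_ord.
Qed.

Lemma rmorph_Phi (S T : comPzRingType) (f : {rmorphism S -> T}) q u :
  f (Phi q u) = Phi q (f u).
Proof. by rewrite rmorph_sum; apply: eq_bigr => i _; rewrite rmorphXn. Qed.

(** In p^2 - 1 = (p - 1)(p + 1) and p^3 - 1 = (p - 1)(p^2 + p + 1) all factors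
are positive and smaller than q. *)
Lemma prime_coprime_pred_expr q p i :
  prime q -> (1 < p)%N -> (p ^ 2 + p + 1 < q)%N -> i = 2%N \/ i = 3%N ->
  coprime q (p ^ i).-1.
Proof.
move=> q_pr p_gt1 ltpq i23; rewrite prime_coprime //.
have p1_gt0 : (0 < p.-1)%N by rewrite -ltnS prednK // ltnW.
have small m : (0 < m)%N -> (m <= p ^ 2 + p + 1)%N -> ~~ (q %| m)%N.
  move=> m_gt0 lem; apply/negP => /(dvdn_leq m_gt0).
  by rewrite leqNgt (leq_ltn_trans lem ltpq).
rewrite -subn1 -(exp1n i) subn_exp.
rewrite Euclid_dvdM // negb_or subn1 !small //.
- by case: i23 => ->; rewrite !big_ord_recl big_ord0 /= !exp1n !muln1; lia.
- case: i23 => ->; rewrite !big_ord_recl big_ord0 /= !exp1n !muln1;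
    by move: (p ^ 2)%N => p2; rewrite /bump /= expn1 expn0; lia.
- by move: (p ^ 2)%N => p2; lia.
Qed.

(** If q <= p^2 + p + 1 <= N + p + 1, then k q <= k (N + 1) + k p, where
k p <= N and k <= N - 1, so that k q < N^2 + N. *)
Lemma square_le_lt_cofactor N p k q :
  (N ^ 2 + N + 1 = k * q)%N -> (k ^ 2 < N)%N -> (p ^ 2 <= N)%N ->
  (p ^ 2 + p + 1 < q)%N.
Proof.
move=> Nkq k2N p2N; rewrite ltnNge; apply/negP => leq.
have kpN : (k * p <= N)%N.
  by rewrite -leq_sqr expnMn -[leqRHS]mulnn leq_mul // ltnW.
have ltkN : (k < N)%N by rewrite (leq_ltn_trans _ k2N) // -mulnn; nia.
have : (N ^ 2 + N + 1 <= k * (N + p + 1))%N.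
  by rewrite Nkq leq_mul2l (leq_trans leq) ?orbT // !leq_add2r.
have : (k * N.+1 <= N.-1 * N.+1)%N.
  by rewrite leq_mul2r -ltnS prednK ?ltkN // (leq_ltn_trans _ ltkN).
case: N {Nkq k2N p2N leq} ltkN kpN => // N ltkN kpN /=.
rewrite -mulnn; nia.
Qed.

(** * The two directions of the criterion *)

Section Criterion.
Variables (K : fieldExtType rat) (theta : K) (d : int).
Hypothesis theta3 : theta ^+ 3 = d%:~R.
Hypothesis K_gen : <<1; theta>>%VS = fullv.

(** Otherwise the image u of w in O_K/p would satisfy u^q = 1 and u^(p^i) = u,
hence u = 1 as q is prime to p^i - 1, and q = Phi_q(1) = 0; with p = 0 this
makes the nontrivial ring O_K/p trivial. *)
Lemma Phi_neq0_prime_divisor (N p q : nat) (w : residue_ring K N) :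
  prime p -> (p %| N)%N -> coprime p 3 -> coprimez p%:Z d -> prime q ->
  (p ^ 2 + p + 1 < q)%N -> Phi q w != 0.
Proof.
move=> p_pr p_dvd_N cop_p3 cop_pd q_pr ltpq; apply/eqP.
have [x ->] := pq_proj_surj w.
rewrite -(rmorph_Phi (@pq_proj (ring_of_integers K) N%:R)).
rewrite -(rmorph0 (@pq_proj (ring_of_integers K) N%:R)).
move=> /pq_projP/principal_idealP[y]; rewrite subr0 => PhixN.
pose pi : {rmorphism ring_of_integers K -> residue_ring K p} :=
  @pq_proj (ring_of_integers K) p%:R.
have p0 : p%:R = 0 :> residue_ring K p := @residue_ring_p_char K p.
have Phi0 : Phi q (pi x) = 0.
  rewrite -rmorph_Phi PhixN rmorphM rmorph_nat.
  by rewrite (natr_dvd_char p0 p_dvd_N) mul0r.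
have [i [j [i23 pij]]] := frob_exponent p_pr cop_p3.
have frob : pi x ^+ (p ^ i) = pi x.
  have [a [b [c ->]]] :=
    residue_quadratic p_pr cop_p3 cop_pd theta3 K_gen (pi x).
  have t3 := residue_theta3 p theta3.
  by rewrite (quadratic_frob_id p_pr p0 cop_pd t3 a b c pij).
have pix1 : pi x = 1.
  apply: (@expr_eq1_coprime _ _ q (p ^ i).-1).
  - by apply: prime_coprime_pred_expr; rewrite ?prime_gt1.
  - exact: prime_gt0.
  - exact: Phi_eq0_expr.
  - by rewrite prednK // expn_gt0 prime_gt0.
have cop_pq : coprimez p%:Z q%:Z.
  rewrite coprimezE /= prime_coprime // dvdn_prime2 // neq_ltn.
  by rewrite (leq_ltn_trans _ ltpq) // -addnA addnC -addnA leq_addr.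
have [n qn1] := intr_char_inv p0 cop_pq.
have : pi 1 = pi 0.
  rewrite rmorph1 rmorph0 -qn1 -pmulrn -(Phi_one (residue_ring K p)).
  by rewrite -pix1 Phi0 mul0r.
move=> /pq_projP/principal_idealP[z]; rewrite subr0 => /(congr1 val).
rewrite rmorph1 rmorphM rmorph_nat => /esym pz.
by have := inv_prime_not_integer p_pr pz; rewrite (svalP z).
Qed.

(** In the field O_K/p the nonzero factor u - 1 of u^q - 1 = 0 cancels. *)
Lemma Phi_eq0_inert (p q : nat) (u : residue_ring K p) :
  prime p -> p = 1 %[mod 3] -> coprimez p%:Z d ->
  (d ^+ (p.-1 %/ 3) != 1 %[mod p%:Z])%Z ->
  u ^+ q = 1 -> u != 1 -> Phi q u = 0.
Proof.
move=> p_pr p1 cop_pd noncube uq; rewrite -subr_eq0 => u1.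
have cop_p3 : coprime p 3.
  by rewrite coprime_sym prime_coprime // /dvdn p1.
have t3 := residue_theta3 p theta3.
have [v uv] := noncube_invertible p_pr (@residue_ring_p_char K p) cop_pd t3 p1
  noncube (residue_quadratic p_pr cop_p3 cop_pd theta3 K_gen) u1.
rewrite -[LHS]mul1r -[X in X * _]uv [_ * v]mulrC -mulrA -subrX1 uq subrr.
by rewrite mulr0.
Qed.

End Criterion.

Theorem theorem4p2
    (q : nat) (hq_prime : prime q) (hq : (3 < q)%N)
    (d : int) (hd : squarefreez d)
    (K : fieldExtType rat) (theta : K)
    (htheta : theta ^+ 3 = d%:~R)
    (hK : <<1; theta>>%VS = fullv)
    (hK3 : \dim {:K} = 3%N)
    (N : nat) (hN_pos : (0 < N)%N) (hN3 : N = 1 %[mod 3])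
    (k : nat) (hk_pos : (0 < k)%N)
    (hNkq : (N ^ 2 + N + 1 = k * q)%N)
    (hk : (k%:R : algC) < sqrtC N%:R)
    (hcop : gcdz N%:Z (3 * d) = 1)
    (hres : (d ^+ ((N - 1) %/ 3) != 1 %[mod N%:Z])%Z)
    (w : residue_ring K N) (hw : gen_unitary w) (hwk : w ^+ k != 1) :
  prime N <-> Phi q (w ^+ k) = 0.
Proof.
have cop_d p : (p %| N)%N -> coprimez p%:Z d.
  move=> p_dvd; have : coprimez N%:Z (3 * d) by apply/eqP.
  by rewrite coprimezMr !coprimezE => /andP[_]; apply: coprime_dvdl.
have cop_3 p : (p %| N)%N -> coprime p 3.
  move=> p_dvd; have : coprimez N%:Z (3 * d) by apply/eqP.
  by rewrite coprimezMr !coprimezE => /andP[+ _]; apply: coprime_dvdl.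
have k2N : (k ^ 2 < N)%N.
  rewrite -(ltr_nat algC) natrX -[ltRHS](sqrtCK N%:R).
  by rewrite ltrXn2r // ?ler0n // sqrtC_ge0 ler0n.
have N_gt1 : (1 < N)%N by rewrite (leq_ltn_trans _ k2N) // expn_gt0 hk_pos.
split=> [N_pr | Phi0].
- apply: (Phi_eq0_inert htheta) => //; first exact: cop_d.
  + by rewrite -subn1.
  + by case: hw => _ <-; rewrite -exprM hNkq.
- (* The least prime factor of a composite N has square at most N. *)
  apply: ltn_pdiv2_prime => //; rewrite ltnNge; apply/negP => le_pN.
  have /eqP := Phi0; apply/negP.
  have p_pr : prime (pdiv N) by exact: pdiv_prime.
  apply: (@Phi_neq0_prime_divisor K theta d htheta hK N (pdiv N)) => //.
  + exact: pdiv_dvd.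
  + exact/cop_3/pdiv_dvd.
  + exact/cop_d/pdiv_dvd.
  + exact: square_le_lt_cofactor hNkq k2N le_pN.
Qed.
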